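(* Let $(A,m,u,\Delta,\varepsilon,\Phi,S)$ be a quasi-bialgebra with preantipode over a field $\Bbbk$. If $\Phi$ is in the center of $A\otimes A\otimes A$, then $(A,m,u,\Delta,\varepsilon,s)$ is an ordinary Hopf algebra, where $s(a)=\Phi^1S(a\Phi^2)\Phi^3$ for all $a\in A$. Furthermore, $(A,m,u,\Delta,\varepsilon,\Phi,s,\alpha,\beta)$ is a quasi-Hopf algebra with $\alpha=1$ and $\beta=S(1)$. Moreover, for all $a\in A$ one has $S(a)=\beta s(a)$.
   Context: $\Bbbk$ is a field, $\otimes=\otimes_\Bbbk$; Sweedler notation $\Delta(a)=a_1\otimes a_2$ (summation understood). Quasi-bialgebra: $(A,m,u)$ is an associative unital $\Bbbk$-algebra, $\Delta\colon A\to A\otimes A$ and $\varepsilon\colon A\to\Bbbk$ are algebra maps, $\Phi=\Phi^1\otimes\Phi^2\otimes\Phi^3\in A\otimes A\otimes A$ is invertible with inverse $\Phi^{-1}=\phi^1\otimes\phi^2\otimes\phi^3$, and, writing $A$ for $\mathrm{Id}_A$: $(A\otimes A\otimes\Delta)(\Phi)\cdot(\Delta\otimes A\otimes A)(\Phi)=(1\otimes\Phi)\cdot(A\otimes\Delta\otimes A)(\Phi)\cdot(\Phi\otimes1)$; $(\varepsilon\otimes A\otimes A)(\Phi)=(A\otimes\varepsilon\otimes A)(\Phi)=(A\otimes A\otimes\varepsilon)(\Phi)=1\otimes1$; $(A\otimes\Delta)(\Delta(a))\cdot\Phi=\Phi\cdot(\Delta\otimes A)(\Delta(a))$; $\varepsilon(a_1)a_2=a=a_1\varepsilon(a_2)$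 for all $a\in A$. A preantipode for $A$ is a $\Bbbk$-linear map $S\colon A\to A$ such that, for all $a,b\in A$, $a_1S(ba_2)=\varepsilon(a)S(b)$, $S(a_1b)a_2=\varepsilon(a)S(b)$, and $\Phi^1S(\Phi^2)\Phi^3=1$. A quasi-Hopf algebra is a quasi-bialgebra with elements $\alpha,\beta\in A$ and an antimultiplicative ($\Bbbk$-linear, $s(ab)=s(b)s(a)$) endomorphism $s$ of $A$ such that for all $a\in A$: $s(a_1)\alpha a_2=\varepsilon(a)\alpha$, $a_1\beta s(a_2)=\varepsilon(a)\beta$, $\Phi^1\beta s(\Phi^2)\alpha\Phi^3=1$, $s(\phi^1)\alpha\phi^2\beta s(\phi^3)=1$. *)

(* Defs.v *)
From HB Require Import structures.
From mathcomp Require Import all_boot all_order all_algebra generic_quotient.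
From mathcomp Require Import boolp classical_sets.

Set Implicit Arguments.
Unset Strict Implicit.
Unset Printing Implicit Defensive.

Import GRing.Theory.
Local Open Scope ring_scope.
Local Open Scope quotient_scope.

(* The tensor product of two k-vector spaces: finite formal sums of pairs
   (lists), modulo the congruence generated by bilinearity. *)
Section TensorProduct.
Variables (k : fieldType) (U V : lmodType k).
Implicit Types (s t : seq (U * V)) (u : U) (v : V) (c : k).

Inductive tensor_cong : seq (U * V) -> seq (U * V) -> Prop :=
| tc_refl s : tensor_cong s s
| tc_sym s t : tensor_cong s t -> tensor_cong t s
| tc_trans s t r : tensor_cong s t -> tensor_cong t r -> tensor_cong s r
| tc_cat s s' t t' : tensor_cong s s' -> tensor_cong t t' ->
    tensor_cong (s ++ t) (s' ++ t')
| tc_catC s t : tensor_cong (s ++ t) (t ++ s)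
| tc_addl u u' v : tensor_cong [:: (u + u', v)] [:: (u, v); (u', v)]
| tc_addr u v v' : tensor_cong [:: (u, v + v')] [:: (u, v); (u, v')]
| tc_scale c u v : tensor_cong [:: (c *: u, v)] [:: (u, c *: v)]
| tc_zero v : tensor_cong [:: (0, v)] [::].

Definition tensor_eqv s t : bool := `[< tensor_cong s t >].

Lemma tensor_eqv_refl : reflexive tensor_eqv.
Proof. by move=> s; apply/asboolP; apply: tc_refl. Qed.

Lemma tensor_eqv_sym : symmetric tensor_eqv.
Proof. by move=> s t; apply/asboolP/asboolP; apply: tc_sym. Qed.

Lemma tensor_eqv_trans : transitive tensor_eqv.
Proof.
by move=> t s r /asboolP st /asboolP tr; apply/asboolP; apply: tc_trans tr.
Qed.

Canonical tensor_equiv :=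
  EquivRel tensor_eqv tensor_eqv_refl tensor_eqv_sym tensor_eqv_trans.

Definition tensor : Type := {eq_quot tensor_equiv}.

HB.instance Definition _ := Choice.on tensor.

Definition tensor_class s : tensor := \pi_({eq_quot tensor_equiv}) s.

Definition tens u v : tensor := tensor_class [:: (u, v)].

Lemma tensor_classP s t : tensor_cong s t -> tensor_class s = tensor_class t.
Proof. by move=> st; apply/eqmodP/asboolP. Qed.

Lemma repr_tensor_class s : tensor_cong (repr (tensor_class s)) s.
Proof.
by have /eqmodP/asboolP := reprK (tensor_class s : {eq_quot tensor_equiv}).
Qed.

Lemma tensor_class_repr (x : tensor) : tensor_class (repr x) = x.
Proof. exact: reprK. Qed.

Definition tensor_zero : tensor := tensor_class [::].
Definition tensor_add (x y : tensor) : tensor :=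
  tensor_class (repr x ++ repr y).
Definition formal_scale c s : seq (U * V) := [seq (c *: p.1, p.2) | p <- s].
Definition tensor_scale c (x : tensor) : tensor :=
  tensor_class (formal_scale c (repr x)).
Definition tensor_opp (x : tensor) : tensor := tensor_scale (-1) x.

Lemma formal_scale_cong c s t : tensor_cong s t ->
  tensor_cong (formal_scale c s) (formal_scale c t).
Proof.
elim=> {s t} [s|s t _|s t r _ + _|s s' t t' _ + _ + |s t|u u' v|u v v'|d u v|v] /=.
- exact: tc_refl.
- exact: tc_sym.
- exact: tc_trans.
- by rewrite /formal_scale !map_cat; exact: tc_cat.
- by rewrite /formal_scale !map_cat; exact: tc_catC.
- by rewrite scalerDr; exact: tc_addl.
- exact: tc_addr.
- by rewrite scalerA mulrC -scalerA; exact: tc_scale.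
- by rewrite scaler0; exact: tc_zero.
Qed.

Lemma tensor_addE s t :
  tensor_add (tensor_class s) (tensor_class t) = tensor_class (s ++ t).
Proof. by apply/tensor_classP/tc_cat; exact: repr_tensor_class. Qed.

Lemma tensor_scaleE c s :
  tensor_scale c (tensor_class s) = tensor_class (formal_scale c s).
Proof. by apply/tensor_classP/formal_scale_cong; exact: repr_tensor_class. Qed.

Lemma tensor_addA : associative tensor_add.
Proof.
move=> x y z; rewrite -[x]tensor_class_repr -[y]tensor_class_repr.
by rewrite -[z]tensor_class_repr !tensor_addE catA.
Qed.

Lemma tensor_addC : commutative tensor_add.
Proof. by move=> x y; apply/tensor_classP/tc_catC. Qed.

Lemma tensor_add0 : left_id tensor_zero tensor_add.
Proof. by move=> x; rewrite -[x]tensor_class_repr tensor_addE. Qed.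

Lemma formal_scaleDl c d s :
  tensor_cong (formal_scale (c + d) s) (formal_scale c s ++ formal_scale d s).
Proof.
elim: s => [|[u v] s IHs] /=; first exact: tc_refl.
apply: (@tc_trans _ ([:: (c *: u, v); (d *: u, v)]
                     ++ (formal_scale c s ++ formal_scale d s))).
  by rewrite -cat1s scalerDl; apply: tc_cat IHs; exact: tc_addl.
rewrite -(cat1s (c *: u, v)) -[in X in tensor_cong _ X](cat1s (c *: u, v)).
rewrite -!catA; apply: tc_cat; first exact: tc_refl.
rewrite catA -(cat1s (d *: u, v) (formal_scale d s)) catA.
by apply: tc_cat; [exact: tc_catC|exact: tc_refl].
Qed.

Lemma formal_scale0 s : tensor_cong (formal_scale 0 s) [::].
Proof.
elim: s => [|[u v] s IHs] /=; first exact: tc_refl.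
rewrite -cat1s scale0r -[X in tensor_cong _ X]cat0s.
by apply: tc_cat IHs; exact: tc_zero.
Qed.

Lemma tensor_addN : left_inverse tensor_zero tensor_opp tensor_add.
Proof.
move=> x; rewrite -[x]tensor_class_repr /tensor_opp tensor_scaleE tensor_addE.
have {2}-> : repr x = formal_scale 1 (repr x).
  by rewrite -[LHS]map_id; apply: eq_map => -[u v] /=; rewrite scale1r.
apply/tensor_classP/(tc_trans (tc_sym (formal_scaleDl _ _ _))).
by rewrite addNr; exact: formal_scale0.
Qed.

HB.instance Definition _ :=
  GRing.isZmodule.Build tensor tensor_addA tensor_addC tensor_add0 tensor_addN.

Lemma tensor_scaleA c d (x : tensor) :
  tensor_scale c (tensor_scale d x) = tensor_scale (c * d) x.
Proof.
rewrite -[x]tensor_class_repr !tensor_scaleE; congr tensor_class.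
by rewrite /formal_scale -map_comp; apply: eq_map => p /=; rewrite scalerA.
Qed.

Lemma tensor_scale1 : left_id 1 tensor_scale.
Proof.
move=> x; rewrite -[x]tensor_class_repr tensor_scaleE; congr tensor_class.
by rewrite -[RHS]map_id; apply: eq_map => -[u v] /=; rewrite scale1r.
Qed.

Lemma tensor_scaleDr : right_distributive tensor_scale +%R.
Proof.
move=> c x y; rewrite -[x]tensor_class_repr -[y]tensor_class_repr.
rewrite -[_ + _]/(tensor_add _ _) -[RHS]/(tensor_add _ _).
by rewrite !(tensor_addE, tensor_scaleE) /formal_scale map_cat.
Qed.

Lemma tensor_scaleDl (x : tensor) : {morph tensor_scale^~ x : c d / c + d}.
Proof.
move=> c d; rewrite -[x]tensor_class_repr -[RHS]/(tensor_add _ _).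
by rewrite !tensor_scaleE tensor_addE; apply/tensor_classP/formal_scaleDl.
Qed.

HB.instance Definition _ := GRing.Zmodule_isLmodule.Build k tensor
  tensor_scaleA tensor_scale1 tensor_scaleDr tensor_scaleDl.

Lemma tens_bilinear : bilinear_for *:%R *:%R tens.
Proof.
have sclE c u v : c *: tens u v = tens (c *: u) v by apply: tensor_scaleE.
have addE (x y : tensor) : x + y = tensor_add x y by [].
split=> [v c u u'|u c v v'] /=.
  rewrite sclE addE tensor_addE; apply/tensor_classP; exact: tc_addl.
rewrite sclE addE tensor_addE; apply/tensor_classP.
apply: (tc_trans (tc_addr _ _ _)).
exact: (@tc_cat [:: _] [:: _] [:: _] [:: _] (tc_sym (tc_scale _ _ _)) (tc_refl _)).
Qed.

Lemma tensor_classE s : tensor_class s = \sum_(p <- s) tens p.1 p.2.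
Proof.
elim: s => [|[u v] s IHs]; first by rewrite big_nil.
by rewrite big_cons /= -IHs; symmetry; apply: tensor_addE.
Qed.

(* Sweedler notation: f evaluated along some decomposition t = \sum_i u_i (x) v_i.
   For bilinear f this is independent of the decomposition, and
   [sweedler f] is the linear map induced by f (see [tensor_universal]). *)
Definition sweedler (W : zmodType) (f : U -> V -> W) (t : tensor) : W :=
  \sum_(p <- repr t) f p.1 p.2.

Section Lift.
Variables (W : lmodType k) (f : U -> V -> W).
Hypothesis f_bilin : bilinear_for *:%R *:%R f.

Let fDl u u' v : f (u + u') v = f u v + f u' v.
Proof. by have := f_bilin.1 v 1 u u'; rewrite /= !scale1r. Qed.
Let fDr u v v' : f u (v + v') = f u v + f u v'.
Proof. by have := f_bilin.2 u 1 v v'; rewrite /= !scale1r. Qed.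
Let f0l v : f 0 v = 0.
Proof. by apply: (addrI (f 0 v)); rewrite -fDl !addr0. Qed.
Let f0r u : f u 0 = 0.
Proof. by apply: (addrI (f u 0)); rewrite -fDr !addr0. Qed.
Let fZl c u v : f (c *: u) v = c *: f u v.
Proof. by have := f_bilin.1 v c u 0; rewrite /= f0l !addr0. Qed.
Let fZr c u v : f u (c *: v) = c *: f u v.
Proof. by have := f_bilin.2 u c v 0; rewrite /= f0r !addr0. Qed.

Lemma sum_tensor_cong s t : tensor_cong s t ->
  \sum_(p <- s) f p.1 p.2 = \sum_(p <- t) f p.1 p.2.
Proof.
elim=> {s t} [s|s t _|s t r _ + _|s s' t t' _ + _ + |s t|u u' v|u v v'|d u v|v] //=.
- by move=> -> ->.
- by move=> e1 e2; rewrite !big_cat /= e1 e2.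
- by rewrite !big_cat /= addrC.
- by rewrite !big_cons big_nil /= !addr0 fDl.
- by rewrite !big_cons big_nil /= !addr0 fDr.
- by rewrite !big_cons big_nil /= !addr0 fZl fZr.
- by rewrite !big_cons big_nil /= f0l !addr0.
Qed.

Lemma sweedler_class s :
  sweedler f (tensor_class s) = \sum_(p <- s) f p.1 p.2.
Proof. exact/sum_tensor_cong/repr_tensor_class. Qed.

Lemma sweedler_tens u v : sweedler f (tens u v) = f u v.
Proof. by rewrite sweedler_class big_seq1. Qed.

Lemma sweedler_linear : linear (sweedler f).
Proof.
move=> c x y; rewrite -[x]tensor_class_repr -[y]tensor_class_repr.
rewrite -[c *: _]/(tensor_scale _ _) -[X in sweedler f X]/(tensor_add _ _).
rewrite tensor_scaleE tensor_addE !sweedler_class big_cat big_map scaler_sumr.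
by congr (_ + _); apply: eq_bigr => p _ /=; rewrite fZl.
Qed.

End Lift.

Lemma tensor_ind (P : tensor -> Prop) :
  P 0 -> (forall u v x, P x -> P (tens u v + x)) -> forall x, P x.
Proof.
move=> P0 PS x; rewrite -[x]tensor_class_repr tensor_classE.
by elim: (repr x) => [|p s IHs]; rewrite ?big_nil ?big_cons //; apply: PS.
Qed.

Lemma tensor_linear_ext (W : lmodType k) (g h : tensor -> W) :
  linear g -> linear h -> (forall u v, g (tens u v) = h (tens u v)) ->
  forall x, g x = h x.
Proof.
move=> gl hl gh.
have lin0 (l : tensor -> W) : linear l -> l 0 = 0.
  by move=> /(_ (-1) 0 0) /=; rewrite !scaleN1r oppr0 !addr0 addNr.
apply: tensor_ind => [|u v x IHx]; first by rewrite !lin0.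
by rewrite -[tens u v]scale1r gl hl gh IHx.
Qed.

Theorem tensor_universal (W : lmodType k) (f : U -> V -> W) :
  bilinear_for *:%R *:%R f ->
  [/\ linear (sweedler f), forall u v, sweedler f (tens u v) = f u v
    & forall g : tensor -> W, linear g -> (forall u v, g (tens u v) = f u v) ->
        forall x, g x = sweedler f x].
Proof.
move=> fb; split; [exact: sweedler_linear|exact: sweedler_tens|move=> g gl gf].
apply: tensor_linear_ext => //; first exact: sweedler_linear.
by move=> u v; rewrite gf sweedler_tens.
Qed.

End TensorProduct.

Arguments tensor_class {k U V} s.
Arguments tens {k U V} u v.

Arguments tensor {k} (U V)%_type.

Notation "U ⊗ V" := (tensor U V) (at level 40, left associativity) : type_scope.
Notation "u ⊗ v" := (tens u v) (at level 40, left associativity) : ring_scope.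

(* Nontriviality of the algebra A ⊗ B: pure tensors of nonzero vectors are
   nonzero, since nonzero vectors are separated from 0 by linear forms. *)
Section LinearForm.
Variables (k : fieldType) (U : lmodType k) (u0 : U).
Hypothesis u0_neq0 : u0 != 0.

Let avoids : set (set U) := fun D =>
  (forall c x y, D x -> D y -> D (c *: x + y)) /\ ~ D u0.

Lemma avoiding_hyperplane : exists H : set U,
  [/\ H 0, avoids H & forall x, exists c, H (x - c *: u0)].
Proof.
have [F Fav Ftot|H [[Hlin Hu0] Hmax]] := @Zorn_bigcup U avoids.
  split=> [c x y [X FX Xx] [Y FY Yy]|[X FX Xu0]]; last by case: (Fav _ FX).
  have [XY|YX] := Ftot _ _ FX FY.
    by exists Y => //; apply: (Fav _ FY).1 => //; exact: XY.
  by exists X => //; apply: (Fav _ FX).1 => //; exact: YX.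
have H0 : H 0.
  apply: contrapT => nH0; apply: (Hmax (fun x => H x \/ x = 0)).
    by split=> [x Hx|sub]; [left|apply: nH0; apply: sub; right].
  split=> [c x y [Hx|->] [Hy|->]|[//|/eqP]]; last by rewrite (negPf u0_neq0).
  - by left; exact: Hlin.
  - left; suff -> : c *: x + 0 = (c - 1) *: x + x by exact: Hlin.
    by rewrite scalerBl scale1r subrK addr0.
  - by left; rewrite scaler0 add0r.
  - by right; rewrite scaler0 addr0.
exists H; split=> // x; have [Hx|nHx] := pselect (H x).
  by exists 0; rewrite scale0r subr0.
pose B : set U := fun y => exists h c, H h /\ y = h + c *: x.
have BsupH : (H `<` B)%classic.
  split=> [h Hh|]; first by exists h, 0; rewrite scale0r addr0.
  by move=> /(_ x) HBx; apply: nHx; apply: HBx; exists 0, 1; rewrite scale1r add0r.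
have [h [c [Hh u0E]]] : B u0.
  apply: contrapT => nB; apply: (Hmax B) => //; split=> // c y z.
  move=> [h [d [Hh ->]]] [h' [d' [Hh' ->]]].
  exists (c *: h + h'), (c * d + d'); split; first exact: Hlin.
  by rewrite scalerDr scalerDl scalerA addrACA.
have c_neq0 : c != 0.
  by apply/eqP => c0; apply: Hu0; rewrite u0E c0 scale0r addr0.
exists c^-1; rewrite u0E scalerDr scalerA mulVf // scale1r opprD addrCA subrr.
by rewrite -scaleNr; apply: (Hlin).
Qed.

Lemma separating_form : exists f : U -> k^o, linear f /\ f u0 = 1.
Proof.
have [H [H0 [Hlin Hu0] /choice[f Hf]]] := avoiding_hyperplane.
have fE x c : H (x - c *: u0) -> f x = c.
  move=> Hx; apply/eqP; apply: contrapT => /negP fx_neq; apply: Hu0.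
  have d_neq0 : f x - c != 0 by rewrite subr_eq0.
  have -> : u0 = - (f x - c)^-1 *: (x - f x *: u0)
               + ((f x - c)^-1 *: (x - c *: u0) + 0).
    rewrite addr0 scaleNr -scalerN -scalerDr opprB addrA subrK -scalerBl.
    by rewrite scalerA mulVf // scale1r.
  by apply: (Hlin) => //; apply: (Hlin).
exists f; split=> [c x y|]; last by apply: fE; rewrite scale1r subrr.
apply: fE; rewrite scalerDl -scalerA opprD addrACA -scalerBr.
by apply: (Hlin).
Qed.

End LinearForm.

Lemma tens_neq0 (k : fieldType) (U V : lmodType k) (u : U) (v : V) :
  u != 0 -> v != 0 -> u ⊗ v != 0.
Proof.
move=> /separating_form[f [fl fu]] /separating_form[g [gl gv]].
have fg : bilinear_for *:%R *:%R (fun x y => f x * g y : k^o).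
  split=> [y|x] c a b /=; first by rewrite fl mulrDl -scalerAl.
  by rewrite gl mulrDr -scalerAr.
apply/eqP => uv0; have := sweedler_tens fg u v.
rewrite uv0 fu gv mulr1 (sweedler_class fg [::]) big_nil => /esym/eqP.
by rewrite oner_eq0.
Qed.

Section TensorAlgebra.
Variables (k : fieldType).

Lemma sweedler_bilinear_param (U V U' V' W : lmodType k)
  (f : U -> V -> U' -> V' -> W) :
  (forall x y, bilinear_for *:%R *:%R (f x y)) ->
  (forall x y, bilinear_for *:%R *:%R (fun a b => f a b x y)) ->
  bilinear_for *:%R *:%R
    (fun (t : U ⊗ V) (t' : U' ⊗ V') =>
       sweedler (fun a b => sweedler (f a b) t') t).
Proof.
move=> f2 f1.
have inner t' : bilinear_for *:%R *:%R (fun a b => sweedler (f a b) t').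
  split=> [b|a] c x y /=; rewrite /sweedler scaler_sumr -big_split /=;
    apply: eq_bigr => p _.
    by have := (f1 p.1 p.2).1 b c x y.
  by have := (f1 p.1 p.2).2 a c x y.
split=> [t'|t] c x y /=; first exact: (sweedler_linear (inner t')).
rewrite {1 2 3}/sweedler scaler_sumr -big_split /=; apply: eq_bigr => p _.
exact: (sweedler_linear (f2 p.1 p.2)).
Qed.

Variables (A B : algType k).

Definition tensor_one : A ⊗ B := 1 ⊗ 1.
Definition tensor_mul (x y : A ⊗ B) : A ⊗ B :=
  sweedler (fun a b => sweedler (fun c d => (a * c) ⊗ (b * d)) y) x.

Let tensl (a a' : A) (b : B) c :
  (c *: a + a') ⊗ b = c *: (a ⊗ b) + a' ⊗ b.
Proof. exact: (tens_bilinear A B).1. Qed.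
Let tensr (a : A) (b b' : B) c :
  a ⊗ (c *: b + b') = c *: (a ⊗ b) + a ⊗ b'.
Proof. exact: (tens_bilinear A B).2. Qed.

Lemma tensor_mul_bilinear : bilinear_for *:%R *:%R tensor_mul.
Proof.
apply: sweedler_bilinear_param => a b; split=> x c u v /=.
- by rewrite mulrDr -scalerAr tensl.
- by rewrite mulrDr -scalerAr tensr.
- by rewrite mulrDl -scalerAl tensl.
- by rewrite mulrDl -scalerAl tensr.
Qed.

Lemma tensor_mulE (a c : A) (b d : B) :
  tensor_mul (a ⊗ b) (c ⊗ d) = (a * c) ⊗ (b * d).
Proof.
have inner a' b' :
    bilinear_for *:%R *:%R (fun c d => (a' * c) ⊗ (b' * d) : A ⊗ B).
  by split=> x e u v /=; rewrite mulrDr -scalerAr ?tensl ?tensr.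
rewrite /tensor_mul sweedler_tens ?sweedler_tens //.
split=> x e u v /=; rewrite /sweedler scaler_sumr -big_split /=;
  apply: eq_bigr => p _; by rewrite mulrDl -scalerAl ?tensl ?tensr.
Qed.

Let mulDl : left_distributive tensor_mul +%R.
Proof.
by move=> x y z; have := tensor_mul_bilinear.1 z 1 x y; rewrite /= !scale1r.
Qed.
Let mulDr : right_distributive tensor_mul +%R.
Proof.
by move=> x y z; have := tensor_mul_bilinear.2 x 1 y z; rewrite /= !scale1r.
Qed.
Let mul0 x : tensor_mul 0 x = 0.
Proof. by apply: (addrI (tensor_mul 0 x)); rewrite -mulDl !addr0. Qed.
Let mul0r x : tensor_mul x 0 = 0.
Proof. by apply: (addrI (tensor_mul x 0)); rewrite -mulDr !addr0. Qed.

Lemma tensor_mulA : associative tensor_mul.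
Proof.
move=> x y z; elim/tensor_ind: x => [|a b x IHx]; first by rewrite !mul0.
rewrite !mulDl IHx; congr (_ + _).
elim/tensor_ind: y {x IHx} => [|c d y IHy]; first by rewrite mul0 !mul0r mul0.
rewrite mulDl !mulDr mulDl IHy; congr (_ + _).
elim/tensor_ind: z {y IHy} => [|e f z IHz]; first by rewrite !mul0r.
by rewrite !mulDr IHz !tensor_mulE !mulrA.
Qed.

Lemma tensor_mul1l : left_id tensor_one tensor_mul.
Proof.
elim/tensor_ind=> [|a b x IHx]; first by rewrite mul0r.
by rewrite mulDr IHx tensor_mulE !mul1r.
Qed.

Lemma tensor_mul1r : right_id tensor_one tensor_mul.
Proof.
elim/tensor_ind=> [|a b x IHx]; first by rewrite mul0.
by rewrite mulDl IHx tensor_mulE !mulr1.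
Qed.

Lemma tensor_one_neq0 : tensor_one != 0.
Proof. by apply: tens_neq0; exact: oner_neq0. Qed.

HB.instance Definition _ := GRing.Zmodule_isNzRing.Build (A ⊗ B)%type
  tensor_mulA tensor_mul1l tensor_mul1r mulDl mulDr tensor_one_neq0.

Lemma tensor_scaleAl c (x y : A ⊗ B) : c *: (x * y) = (c *: x) * y.
Proof.
have := tensor_mul_bilinear.1 y c x 0; rewrite /= mul0 !addr0; exact: esym.
Qed.
HB.instance Definition _ :=
  GRing.Lmodule_isLalgebra.Build k (A ⊗ B)%type tensor_scaleAl.

Lemma tensor_scaleAr c (x y : A ⊗ B) : c *: (x * y) = x * (c *: y).
Proof.
have := tensor_mul_bilinear.2 x c y 0; rewrite /= mul0r !addr0; exact: esym.
Qed.
HB.instance Definition _ :=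
  GRing.Lalgebra_isAlgebra.Build k (A ⊗ B)%type tensor_scaleAr.

Lemma tensorM (a c : A) (b d : B) : (a ⊗ b) * (c ⊗ d) = (a * c) ⊗ (b * d).
Proof. exact: tensor_mulE. Qed.

End TensorAlgebra.

Section TensorMaps.
Variable (k : fieldType).
Implicit Types U V W X : lmodType k.

Definition tmap (U V U' V' : lmodType k) (f : U -> U') (g : V -> V') :
    U ⊗ V -> U' ⊗ V' :=
  sweedler (fun x y => f x ⊗ g y).

(* The associativity isomorphism; iterated tensor products are bracketed to
   the left throughout. *)
Definition tassocl U V W : U ⊗ (V ⊗ W) -> U ⊗ V ⊗ W :=
  sweedler (fun x => sweedler (fun y z => x ⊗ y ⊗ z)).

(* f ⊗ id and id ⊗ f for a linear form f, modulo k ⊗ U = U = U ⊗ k. *)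
Definition tforml U V (f : U -> k) : U ⊗ V -> V :=
  sweedler (fun x y => f x *: y).
Definition tformr U V (f : V -> k) : U ⊗ V -> U :=
  sweedler (fun x y => f y *: x).

Definition sweedler3 U V W (X : zmodType) (f : U -> V -> W -> X) :
    U ⊗ V ⊗ W -> X :=
  sweedler (fun t z => sweedler (fun x y => f x y z) t).

Lemma tens_linl U V (v : V) : linear (fun u : U => u ⊗ v).
Proof. exact: (tens_bilinear U V).1. Qed.

Lemma tens_linr U V (u : U) : linear (fun v : V => u ⊗ v).
Proof. exact: (tens_bilinear U V).2. Qed.

Lemma sweedler_sum_linear U V W X (f : W -> U -> V -> X) (t : U ⊗ V) :
  (forall u v, linear (fun w => f w u v)) -> linear (fun w => sweedler (f w) t).
Proof.
move=> fl c x y; rewrite /sweedler scaler_sumr -big_split /=.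
by apply: eq_bigr => p _; exact: fl.
Qed.

Section TensorMap.
Variables (U V U' V' : lmodType k).
Variables (f : {linear U -> U'}) (g : {linear V -> V'}).

Let tmap_bilinear : bilinear_for *:%R *:%R (fun x y => f x ⊗ g y).
Proof.
by split=> [z|z] c x y /=; rewrite linearP ?tens_linl ?tens_linr.
Qed.

Lemma tmap_linear : linear (tmap f g).
Proof. exact: sweedler_linear. Qed.

Lemma tmap_tens u v : tmap f g (u ⊗ v) = f u ⊗ g v.
Proof. exact: (sweedler_tens tmap_bilinear). Qed.

End TensorMap.

Section TensorAssoc.
Variables (U V W : lmodType k).

Let assoc2 (u : U) :
  bilinear_for *:%R *:%R (fun (y : V) (z : W) => u ⊗ y ⊗ z).
Proof. by split=> z c x y /=; rewrite ?tens_linr ?tens_linl. Qed.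

Let assoc1 : bilinear_for *:%R *:%R
  (fun u : U => sweedler (fun (y : V) (z : W) => u ⊗ y ⊗ z)).
Proof.
split=> [t|u]; last exact: sweedler_linear.
by apply: sweedler_sum_linear => v w c x y; rewrite !tens_linl.
Qed.

Lemma tassocl_linear : linear (@tassocl U V W).
Proof. exact: sweedler_linear. Qed.

Lemma tassocl_tens u v w : @tassocl U V W (u ⊗ (v ⊗ w)) = u ⊗ v ⊗ w.
Proof. by rewrite /tassocl (sweedler_tens assoc1) (sweedler_tens (assoc2 u)). Qed.

Lemma sweedler3_tens X (f : U -> V -> W -> X) :
  (forall v w, linear (fun u => f u v w)) ->
  (forall u w, linear (fun v => f u v w)) ->
  (forall u v, linear (f u v)) ->
  linear (sweedler3 f) /\
  forall u v w, sweedler3 f (u ⊗ v ⊗ w) = f u v w.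
Proof.
move=> f1 f2 f3.
have f12 w : bilinear_for *:%R *:%R (fun u v => f u v w) by split=> x.
have f123 : bilinear_for *:%R *:%R
    (fun (t : U ⊗ V) (z : W) => sweedler (fun x y => f x y z) t).
  split=> [w|t]; first exact: (sweedler_linear (f12 w)).
  exact: (sweedler_sum_linear (f := fun z x y => f x y z)).
split=> [|u v w]; first exact: sweedler_linear.
by rewrite /sweedler3 (sweedler_tens f123) (sweedler_tens (f12 w)).
Qed.

End TensorAssoc.

End TensorMaps.

Section QuasiHopf.
Variables (k : fieldType) (A : algType k).
Variables (Delta : {lrmorphism A -> (A ⊗ A)%type})
          (eps : {lrmorphism A -> k | *%R}).
Implicit Types (Phi phi : A ⊗ A ⊗ A) (S s : A -> A) (alpha beta : A).

Record is_quasi_bialgebra Phi phi : Prop := IsQuasiBialgebra {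
  qb_invr : Phi * phi = 1;
  qb_invl : phi * Phi = 1;
  qb_pentagon :
    tassocl (tmap id Delta Phi) * tmap (tmap Delta id) id Phi
    = tmap (@tassocl _ A A A) id (tassocl (1 ⊗ Phi))
      * tmap (fun t => tassocl (tmap id Delta t)) id Phi
      * (Phi ⊗ 1);
  qb_unitl : tmap (tforml eps) id Phi = 1 ⊗ 1;
  qb_unitm : tmap (tformr eps) id Phi = 1 ⊗ 1;
  qb_unitr : tformr eps Phi = 1 ⊗ 1;
  qb_coassoc a :
    tassocl (tmap id Delta (Delta a)) * Phi = Phi * tmap Delta id (Delta a);
  qb_counitl a : tforml eps (Delta a) = a;
  qb_counitr a : tformr eps (Delta a) = a }.

Record is_preantipode Phi S : Prop := IsPreantipode {
  pa_linear : linear S;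
  pa_right a b : sweedler (fun x y => x * S (b * y)) (Delta a) = eps a *: S b;
  pa_left a b : sweedler (fun x y => S (x * b) * y) (Delta a) = eps a *: S b;
  pa_norm : sweedler3 (fun x y z => x * S y * z) Phi = 1 }.

Record is_quasi_hopf Phi phi s alpha beta : Prop := IsQuasiHopf {
  qh_quasi_bialgebra : is_quasi_bialgebra Phi phi;
  qh_linear : linear s;
  qh_antimul a b : s (a * b) = s b * s a;
  qh_alpha a :
    sweedler (fun x y => s x * alpha * y) (Delta a) = eps a *: alpha;
  qh_beta a :
    sweedler (fun x y => x * beta * s y) (Delta a) = eps a *: beta;
  qh_Phi : sweedler3 (fun x y z => x * beta * s y * alpha * z) Phi = 1;
  qh_phi : sweedler3 (fun x y z => s x * alpha * y * beta * s z) phi = 1 }.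

Record is_bialgebra : Prop := IsBialgebra {
  bi_coassoc a :
    tassocl (tmap id Delta (Delta a)) = tmap Delta id (Delta a);
  bi_counitl a : tforml eps (Delta a) = a;
  bi_counitr a : tformr eps (Delta a) = a }.

Record is_hopf s : Prop := IsHopf {
  ho_bialgebra : is_bialgebra;
  ho_linear : linear s;
  ho_antipodel a : sweedler (fun x y => s x * y) (Delta a) = eps a *: 1;
  ho_antipoder a : sweedler (fun x y => x * s y) (Delta a) = eps a *: 1 }.

End QuasiHopf.

(* Main.v *)
Require Import Defs.
From HB Require Import structures.
From mathcomp Require Import all_boot all_order all_algebra.

Set Implicit Arguments.
Unset Strict Implicit.
Unset Printing Implicit Defensive.

Import GRing.Theory.
Local Open Scope ring_scope.

(** Since Phi is invertible and central, quasi-coassociativity is plain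
coassociativity, so A is an ordinary bialgebra.  Centrality also lets an
element of A cross any tensor factor of Phi, so that in
s(a) = Phi^1 S(a Phi^2) Phi^3 the outer factors a_2 of s(a_1 b) a_2 and a_1 of
a_1 s(a_2) can be moved next to S, where the preantipode laws absorb them.
This gives s(a_1 b) a_2 = eps(a) s(b) and a_1 s(a_2) = eps(a)
([central_antipode_left], [central_antipode_right]).  As
s(1) = Phi^1 S(Phi^2) Phi^3 = 1, the case b = 1 makes s an antipode.

In a bialgebra with a right antipode s, f(a_1) a_2 = eps(a) c forces
f(a) = c s(a), by convolving with s ([antipode_cancel]).  Taking f(a) = s(a b)
gives antimultiplicativity of s, and taking f = S gives S(a) = S(1) s(a).

With alpha = 1 and beta = S(1), every occurrence of beta s in the
quasi-Hopf axioms is S, so the axioms on beta and on Phi are preantipode laws.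
The remaining one, s(phi^1) phi^2 S(phi^3) = 1, comes from the
pentagon ([reassociator_inverse_norm]): multiplied by phi (x) 1 on the right it
reads
  (id (x) id (x) Delta)(Phi) (Delta (x) id (x) id)(Phi) (phi (x) 1)
    = (1 (x) Phi) (id (x) Delta (x) id)(Phi),
and the linear map a (x) b (x) c (x) d |-> s(a) b S(c) d collapses each factor
containing Delta to 1, leaving s(phi^1) phi^2 S(phi^3) on the left and
Phi^1 S(Phi^2) Phi^3 = 1 on the right. *)

(** * Linear maps and Sweedler sums *)

Lemma linear_comp (k : fieldType) (X U V : lmodType k)
    (h : U -> V) (f : X -> U) :
  linear h -> linear f -> linear (fun x => h (f x)).
Proof. by move=> hl fl c x y; rewrite fl hl. Qed.

Lemma linear_homogeneous (k : fieldType) (U V : lmodType k) (h : U -> V) c x :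
  linear h -> h (c *: x) = c *: h x.
Proof.
move=> hl; have h0 : h 0 = 0.
  by have := hl (-1) 0 0; rewrite !scaleN1r oppr0 !addr0 addNr.
by have := hl c x 0; rewrite h0 !addr0.
Qed.

Section Linearity.
Variables (k : fieldType) (X U V W Z : lmodType k) (B : algType k).

Lemma linear_tensl (f : X -> U) (v : V) :
  linear f -> linear (fun x => f x ⊗ v).
Proof. by move=> fl c x y; rewrite fl tens_linl. Qed.

Lemma linear_tensr (f : X -> V) (u : U) :
  linear f -> linear (fun x => u ⊗ f x).
Proof. by move=> fl c x y; rewrite fl tens_linr. Qed.

Lemma linear_mull (f : X -> B) b : linear f -> linear (fun x => f x * b).
Proof. by move=> fl c x y; rewrite fl mulrDl -scalerAl. Qed.

Lemma linear_mulr (f : X -> B) b : linear f -> linear (fun x => b * f x).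
Proof. by move=> fl c x y; rewrite fl mulrDr -scalerAr. Qed.

Lemma linear_form (e : {lrmorphism B -> k | *%R}) (f : X -> B) (u : U) :
  linear f -> linear (fun x => e (f x) *: u).
Proof. by move=> fl c x y; rewrite fl linearP scalerDl scalerA. Qed.

Lemma linear_sweedler (h : U -> V -> W) (f : X -> (U ⊗ V)%type) :
  (forall v, linear (fun u => h u v)) -> (forall u, linear (h u)) ->
  linear f -> linear (fun x => sweedler h (f x)).
Proof.
move=> h1 h2; apply: (@linear_comp _ _ _ _ (sweedler h) f).
by apply: sweedler_linear; split.
Qed.

Lemma linear_sweedler_param (h : X -> U -> V -> W) (t : (U ⊗ V)%type) :
  (forall u v, linear (fun x => h x u v)) ->
  linear (fun x => sweedler (h x) t).
Proof. exact: sweedler_sum_linear. Qed.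

Lemma linear_sweedler3_param (h : X -> U -> V -> W -> Z) t :
  (forall u v w, linear (fun x => h x u v w)) ->
  linear (fun x => sweedler3 (h x) t).
Proof.
by move=> hl; apply: sweedler_sum_linear => d w; exact: sweedler_sum_linear.
Qed.

End Linearity.

Lemma linear_tmap (k : fieldType) (X U V U' V' : lmodType k)
    (f : U -> U') (g : V -> V') (h : X -> (U ⊗ V)%type) :
  linear f -> linear g -> linear h -> linear (fun x => tmap f g (h x)).
Proof.
move=> fl gl; apply: linear_sweedler => [v|u].
  exact: linear_tensl.
exact: linear_tensr.
Qed.

Lemma linear_tassocl (k : fieldType) (X U V W : lmodType k)
    (h : X -> (U ⊗ (V ⊗ W))%type) :
  linear h -> linear (fun x => tassocl (h x)).
Proof. exact: (linear_comp (@tassocl_linear _ U V W)). Qed.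

Section LinearCounit.
Variables (k : fieldType) (X U : lmodType k) (B : algType k).
Variable e : {lrmorphism B -> k | *%R}.

Lemma linear_tforml (h : X -> (B ⊗ U)%type) :
  linear h -> linear (fun x => tforml e (h x)).
Proof.
apply: linear_sweedler => [u|b]; first exact: linear_form.
by move=> c x y; rewrite scalerDr !scalerA mulrC.
Qed.

Lemma linear_tformr (h : X -> (U ⊗ B)%type) :
  linear h -> linear (fun x => tformr e (h x)).
Proof.
apply: linear_sweedler => [b|u]; last exact: linear_form.
by move=> c x y; rewrite scalerDr !scalerA mulrC.
Qed.

End LinearCounit.

(** Proves that a map is linear by recursion on its body.  The dispatch is on
the syntax of the body because unification up to conversion would unfold
[sweedler3] and the iterated tensor algebras, which is very slow.  The
[match] on the body backtracks because a product or a tensor may depend on the variable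
through either factor. *)
Ltac linearity := intros; cbv beta;
  first
  [ solve [match goal with
           | H : context [GRing.linear_for] |- _ => simple apply H
           end]
  | lazymatch goal with |- @GRing.linear_for ?K ?U ?V ?l ?h =>
    match h with
    | (fun x => x) => exact (fun c x y => erefl)
    | (fun x => @GRing.mul _ (@?f x) ?b) =>
        refine (linear_mull (f := f) b _); linearity
    | (fun x => @GRing.mul _ ?b (@?f x)) =>
        refine (linear_mulr (f := f) b _); linearity
    | (fun x => @tens _ _ _ (@?f x) ?v) =>
        refine (linear_tensl (f := f) v _); linearity
    | (fun x => @tens _ _ _ ?u (@?f x)) =>
        refine (linear_tensr (f := f) u _); linearity
    | (fun x => @tmap _ _ _ _ _ _ _ (@?f x)) =>
        refine (linear_tmap (h := f) _ _ _); linearity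
    | (fun x => @tassocl _ _ _ _ (@?f x)) =>
        refine (linear_tassocl (h := f) _); linearity
    | (fun x => @tforml _ _ _ _ (@?f x)) =>
        refine (linear_tforml _ (h := f) _); linearity
    | (fun x => @tformr _ _ _ _ (@?f x)) =>
        refine (linear_tformr _ (h := f) _); linearity
    | (fun x => @sweedler _ _ _ _ ?g (@?f x)) =>
        refine (linear_sweedler (h := g) (f := f) _ _ _); linearity
    | (fun x => @sweedler _ _ _ _ (@?g x) ?t) =>
        refine (linear_sweedler_param (h := g) t _); linearity
    | (fun x => @sweedler3 _ _ _ _ _ (@?g x) ?t) =>
        refine (linear_sweedler3_param (h := g) t _); linearity
    | (fun x => @GRing.scale _ _ _ _) =>
        refine (linear_form _ _ _); linearity
    | (fun x => ?h' (@?f x)) =>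
        match goal with
        | H : @GRing.linear_for _ _ _ _ h' |- _ =>
            refine (linear_comp (h := h') (f := f) H _); linearity
        | H : forall _ _, @GRing.linear_for _ _ _ _ _ |- _ =>
            refine (linear_comp (h := h') (f := f) (H _ _) _); linearity
        end
    | (fun x => _) => fail 1
    | _ => change (@GRing.linear_for K U V l (fun x => h x)); cbv beta; linearity
    end end ].

Lemma sweedler_tensE (k : fieldType) (U V X : lmodType k)
    (f : U -> V -> X) u v :
  (forall v, linear (fun u => f u v)) -> (forall u, linear (f u)) ->
  sweedler f (u ⊗ v) = f u v.
Proof. by move=> f1 f2; apply: sweedler_tens; split. Qed.

Lemma tens_scalel (k : fieldType) (U V : lmodType k) c (u : U) (v : V) :
  (c *: u) ⊗ v = c *: (u ⊗ v).
Proof. exact: (linear_homogeneous c u (tens_linl v)). Qed.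

Section PureTensors.
Variables (k : fieldType) (U V W Z X : lmodType k) (B : algType k).
Variable e : {lrmorphism B -> k | *%R}.

Lemma tmapE (f : U -> W) (g : V -> Z) u v :
  linear f -> linear g -> tmap f g (u ⊗ v) = f u ⊗ g v.
Proof. by move=> fl gl; apply: sweedler_tensE => *; linearity. Qed.

Lemma tformlE b (u : U) : tforml e (b ⊗ u) = e b *: u.
Proof.
apply: sweedler_tensE => [v|b']; first by linearity.
by move=> c x y; rewrite scalerDr !scalerA mulrC.
Qed.

Lemma tformrE b (u : U) : tformr e (u ⊗ b) = e b *: u.
Proof.
apply: sweedler_tensE => [b'|v]; last by linearity.
by move=> c x y; rewrite scalerDr !scalerA mulrC.
Qed.

(** Linear maps out of an iterated tensor product are compared on pure
tensors; this turns the multilinear identities below into computations in A. *)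
Lemma tensor3_ext (g h : (U ⊗ V ⊗ W)%type -> X) : linear g -> linear h ->
  (forall u v w, g (u ⊗ v ⊗ w) = h (u ⊗ v ⊗ w)) -> forall t, g t = h t.
Proof.
move=> gl hl gh; apply: tensor_linear_ext => // t w.
have tl : linear (fun t : (U ⊗ V)%type => t ⊗ w) by linearity.
apply: (@tensor_linear_ext _ _ _ _ (fun t => g (t ⊗ w)) (fun t => h (t ⊗ w))).
- exact: linear_comp.
- exact: linear_comp.
- by move=> u v; exact: gh.
Qed.

End PureTensors.

Lemma tensor4_ext (k : fieldType) (U V W Z X : lmodType k)
    (g h : (U ⊗ V ⊗ W ⊗ Z)%type -> X) : linear g -> linear h ->
  (forall u v w z, g (u ⊗ v ⊗ w ⊗ z) = h (u ⊗ v ⊗ w ⊗ z)) ->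
  forall t, g t = h t.
Proof.
move=> gl hl gh; apply: tensor3_ext => // t w z.
have tl : linear (fun t : (U ⊗ V)%type => t ⊗ w ⊗ z) by linearity.
apply: (@tensor_linear_ext _ _ _ _ (fun t => g (t ⊗ w ⊗ z))
          (fun t => h (t ⊗ w ⊗ z))).
- exact: linear_comp.
- exact: linear_comp.
- by move=> u v; exact: gh.
Qed.

Section SweedlerSums.
Variables (k : fieldType) (U V : lmodType k).

Lemma eq_sweedler (X : zmodType) (f g : U -> V -> X) t :
  (forall u v, f u v = g u v) -> sweedler f t = sweedler g t.
Proof. by move=> fg; apply: eq_bigr => p _. Qed.

Lemma sweedler_mull (B : algType k) (f : U -> V -> B) b t :
  sweedler f t * b = sweedler (fun x y => f x y * b) t.
Proof. exact: mulr_suml. Qed.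

Lemma sweedler_mulr (B : algType k) (f : U -> V -> B) b t :
  b * sweedler f t = sweedler (fun x y => b * f x y) t.
Proof. exact: mulr_sumr. Qed.

End SweedlerSums.

Section SweedlerSums3.
Variables (k : fieldType) (U V W : lmodType k).

Lemma eq_sweedler3 (X : zmodType) (f g : U -> V -> W -> X) t :
  (forall u v w, f u v w = g u v w) -> sweedler3 f t = sweedler3 g t.
Proof. by move=> fg; apply: eq_sweedler => *; apply: eq_sweedler. Qed.

Lemma exchange_sweedler3 (X : zmodType) (U' V' : lmodType k)
    (f : U' -> V' -> U -> V -> W -> X) d t :
  sweedler (fun p q => sweedler3 (f p q) t) d
    = sweedler3 (fun x y z => sweedler (fun p q => f p q x y z) d) t.
Proof.
rewrite /sweedler3 /sweedler exchange_big /=; apply: eq_bigr => r _.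
exact: exchange_big.
Qed.

Lemma sweedler3_mull (B : algType k) (f : U -> V -> W -> B) b t :
  sweedler3 f t * b = sweedler3 (fun x y z => f x y z * b) t.
Proof.
by rewrite sweedler_mull; apply: eq_sweedler => *; rewrite sweedler_mull.
Qed.

Lemma sweedler3_mulr (B : algType k) (f : U -> V -> W -> B) b t :
  b * sweedler3 f t = sweedler3 (fun x y z => b * f x y z) t.
Proof.
by rewrite sweedler_mulr; apply: eq_sweedler => *; rewrite sweedler_mulr.
Qed.

Lemma sweedler3_scale (Y : lmodType k) (f : U -> V -> W -> Y) c t :
  c *: sweedler3 f t = sweedler3 (fun x y z => c *: f x y z) t.
Proof.
rewrite [LHS]scaler_sumr; apply: eq_bigr => p _.
exact: scaler_sumr.
Qed.

End SweedlerSums3.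

(** * Trilinear maps and central elements *)

Section Trilinear.
Variables (k : fieldType) (A : algType k) (X : lmodType k).
Variable f : A -> A -> A -> X.
Hypotheses (f1 : forall y z, linear (fun x => f x y z))
           (f2 : forall x z, linear (fun y => f x y z))
           (f3 : forall x y, linear (f x y)).
Implicit Types u v w : A.

Lemma sweedler3_linear : linear (sweedler3 f).
Proof. by case: (sweedler3_tens f1 f2 f3). Qed.

Lemma sweedler3_tensE u v w : sweedler3 f (u ⊗ v ⊗ w) = f u v w.
Proof. by case: (sweedler3_tens f1 f2 f3). Qed.

Lemma sweedler3_tensr d w :
  sweedler3 f (d ⊗ w) = sweedler (fun x y => f x y w) d.
Proof.
have fl := sweedler3_linear.
apply: (tensor_linear_ext (g := fun d => sweedler3 f (d ⊗ w))) => [||u v].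
- by linearity.
- by linearity.
- by rewrite sweedler3_tensE sweedler_tensE.
Qed.

(** Here [d] is not a pure tensor: in the applications it is a coproduct. *)
Lemma sweedler3_tassocl u d :
  sweedler3 f (tassocl (u ⊗ d)) = sweedler (f u) d.
Proof.
have fl := sweedler3_linear.
apply: (tensor_linear_ext (g := fun d => sweedler3 f (tassocl (u ⊗ d))))
  => [||v w].
- by linearity.
- by linearity.
- by rewrite tassocl_tens sweedler3_tensE sweedler_tensE.
Qed.

End Trilinear.

Section Central.
Variables (k : fieldType) (A : algType k) (X : lmodType k).
Variable f : A -> A -> A -> X.
Hypotheses (f1 : forall y z, linear (fun x => f x y z))
           (f2 : forall x z, linear (fun y => f x y z))
           (f3 : forall x y, linear (f x y)).
Implicit Types (Phi : (A ⊗ A ⊗ A)%type) (u v w : A).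

Let fl : linear (sweedler3 f). Proof. exact: sweedler3_linear. Qed.

Lemma sweedler3_mulr_tens Phi u v w :
  sweedler3 f (Phi * (u ⊗ v ⊗ w))
    = sweedler3 (fun x y z => f (x * u) (y * v) (z * w)) Phi.
Proof.
have g1 y z : linear (fun x => f (x * u) (y * v) (z * w)).
  by apply: (linear_comp (f1 _ _)); linearity.
have g2 x z : linear (fun y => f (x * u) (y * v) (z * w)).
  by apply: (linear_comp (f2 _ _)); linearity.
have g3 x y : linear (fun z => f (x * u) (y * v) (z * w)).
  by apply: (linear_comp (f3 _ _)); linearity.
apply: (tensor3_ext (g := fun t => sweedler3 f (t * _))).
- linearity.
- exact: sweedler3_linear.
- by move=> x y z; rewrite !tensorM !sweedler3_tensE.
Qed.

Lemma sweedler3_mull_tens Phi u v w :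
  sweedler3 f ((u ⊗ v ⊗ w) * Phi)
    = sweedler3 (fun x y z => f (u * x) (v * y) (w * z)) Phi.
Proof.
have g1 y z : linear (fun x => f (u * x) (v * y) (w * z)).
  by apply: (linear_comp (f1 _ _)); linearity.
have g2 x z : linear (fun y => f (u * x) (v * y) (w * z)).
  by apply: (linear_comp (f2 _ _)); linearity.
have g3 x y : linear (fun z => f (u * x) (v * y) (w * z)).
  by apply: (linear_comp (f3 _ _)); linearity.
apply: (tensor3_ext (g := fun t => sweedler3 f (_ * t))).
- linearity.
- exact: sweedler3_linear.
- by move=> x y z; rewrite !tensorM !sweedler3_tensE.
Qed.

(** Elements of A can be moved from one side of a leg of a central tensor to the
other, in one leg at a time by taking the other two elements to be 1. *)
Lemma sweedler3_central Phi u v w :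
  (forall t : (A ⊗ A ⊗ A)%type, Phi * t = t * Phi) ->
  sweedler3 (fun x y z => f (x * u) (y * v) (z * w)) Phi
    = sweedler3 (fun x y z => f (u * x) (v * y) (w * z)) Phi.
Proof. by move=> PhiC; rewrite -sweedler3_mulr_tens PhiC sweedler3_mull_tens. Qed.

End Central.

(** * Convolution in a bialgebra *)

Section Cancellation.
Variables (k : fieldType) (A : algType k).
Variables (Delta : {lrmorphism A -> (A ⊗ A)%type})
          (eps : {lrmorphism A -> k | *%R}).
Hypothesis bi : is_bialgebra Delta eps.

Lemma Delta_linear : linear Delta. Proof. exact: linearP. Qed.

(** The convolution f * id * s is computed in two ways: id * s is the unit
for convolution, and f * id is c times the unit. *)
Lemma antipode_cancel (s f : A -> A) c : linear s -> linear f ->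
  (forall a, sweedler (fun x y => x * s y) (Delta a) = eps a *: 1) ->
  (forall a, sweedler (fun x y => f x * y) (Delta a) = eps a *: c) ->
  forall a, f a = c * s a.
Proof.
move=> sl fl sE fE a.
have Dl := Delta_linear.
pose g x y z := f x * y * s z.
have gl : linear (sweedler3 g) by apply: sweedler3_linear; rewrite /g; linearity.
have resum_right t : sweedler3 g (tassocl (tmap id Delta t)) = f (tformr eps t).
  apply: (tensor_linear_ext (g := fun t => sweedler3 g _)
            (h := fun t => f (tformr eps t))) => [||x d].
  - by linearity.
  - by linearity.
  rewrite tmapE; [|linearity|linearity].
  rewrite sweedler3_tassocl; [|by rewrite /g; linearity..].
  rewrite tformrE.
  transitivity (f x * sweedler (fun y z => y * s z) (Delta d)).
    by rewrite sweedler_mulr; apply: eq_sweedler => y z; rewrite mulrA.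
  by rewrite sE -scalerAr mulr1 (linear_homogeneous _ _ fl).
have resum_left t : sweedler3 g (tmap Delta id t) = c * s (tforml eps t).
  apply: (tensor_linear_ext (g := fun t => sweedler3 g _)
            (h := fun t => c * s (tforml eps t))) => [||d z].
  - by linearity.
  - by linearity.
  rewrite tmapE; [|linearity|linearity].
  rewrite sweedler3_tensr; [|by rewrite /g; linearity..].
  by rewrite tformlE -sweedler_mull fE -scalerAl (linear_homogeneous _ _ sl) scalerAr.
rewrite -{1}[a](bi_counitr bi) -resum_right (bi_coassoc bi) resum_left.
by rewrite (bi_counitl bi).
Qed.

End Cancellation.

(** * The pentagon and the inverse reassociator *)

Section Pentagon.
Variables (k : fieldType) (A : algType k).
Variables (Delta : {lrmorphism A -> (A ⊗ A)%type})
          (eps : {lrmorphism A -> k | *%R}).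
Variables (Phi phi : (A ⊗ A ⊗ A)%type) (s S : A -> A).
Hypotheses (qb : is_quasi_bialgebra Delta eps Phi phi)
           (hS : is_preantipode Delta eps Phi S).
Hypotheses (sl : linear s) (s1 : s 1 = 1).
Hypothesis s_left :
  forall a b, sweedler (fun x y => s (x * b) * y) (Delta a) = eps a *: s b.

(** The functional applied to the pentagon.  Its factors [s a * b],
[b * S c] and [S c * d] meet the two legs of the coproduct sitting in positions
(1,2), (2,3) and (3,4), so that one law of [s] or [S] collapses each. *)
Let F : (A ⊗ A ⊗ A ⊗ A)%type -> A :=
  sweedler (fun t d => sweedler3 (fun a b c => s a * b * S c * d) t).

Let Sl : linear S. Proof. exact: pa_linear hS. Qed.
Let Dl : linear Delta. Proof. exact: linearP. Qed.

Let inner_linear d : linear (sweedler3 (fun a b c => s a * b * S c * d)).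
Proof. by apply: sweedler3_linear; linearity. Qed.

Let Fl : linear F.
Proof. by apply: sweedler_linear; split=> z; [exact: inner_linear|linearity]. Qed.

Let F_tens a b c d : F (a ⊗ b ⊗ c ⊗ d) = s a * b * S c * d.
Proof.
rewrite /F sweedler_tensE; [|exact: inner_linear|linearity].
by rewrite sweedler3_tensE //; linearity.
Qed.

Let Fl_mull (u : (A ⊗ A ⊗ A ⊗ A)%type) : linear (fun t => F (t * u)).
Proof. linearity. Qed.

Let Fl_mulr (u : (A ⊗ A ⊗ A ⊗ A)%type) : linear (fun t => F (u * t)).
Proof. linearity. Qed.

(** Each collapse lemma replaces the coproduct by the counit in presence of
another factor [u].  The coproduct has to be the left factor for the laws of
the form S(a_1 b) a_2 = eps(a) S(b), and the right factor for
a_1 S(b a_2) = eps(a) S(b); the pentagon provides these orders. *)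
Let F_collapse_right (t : (A ⊗ A ⊗ A)%type) (u : (A ⊗ A ⊗ A ⊗ A)%type) :
  F (tassocl (tmap id Delta t) * u) = F ((tformr eps t ⊗ 1 ⊗ 1) * u).
Proof.
apply: (tensor4_ext (g := fun u => F (_ * u)) (h := fun u => F (_ * u)))
  => [||a b c e].
- exact: Fl_mulr.
- exact: Fl_mulr.
apply: (tensor3_ext (g := fun t => F (tassocl (tmap id Delta t) * _))
  (h := fun t => F ((tformr eps t ⊗ 1 ⊗ 1) * _))) => [||x y z].
- refine (linear_comp (Fl_mull _) _); linearity.
- refine (linear_comp (Fl_mull _) _); linearity.
have split_last d : F (tassocl ((x ⊗ y) ⊗ d) * (a ⊗ b ⊗ c ⊗ e))
    = s (x * a) * (y * b) * sweedler (fun p q => S (p * c) * q) d * e.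
  apply: (tensor_linear_ext (g := fun d => F (tassocl (_ ⊗ d) * _))
    (h := fun d => _ * sweedler _ d * _)) => [||p q].
  - refine (linear_comp (Fl_mull _) _); linearity.
  - by linearity.
  rewrite tassocl_tens !tensorM F_tens sweedler_tensE; [|linearity|linearity].
  by rewrite !mulrA.
rewrite tmapE; [|linearity|linearity].
rewrite split_last (pa_left hS) tformrE.
rewrite -tens_scalel !tensorM F_tens !mul1r -scalerAl (linear_homogeneous _ _ sl).
by rewrite -!(scalerAl, scalerAr).
Qed.

Let F_collapse_left (t : (A ⊗ A ⊗ A)%type) (u : (A ⊗ A ⊗ A ⊗ A)%type) :
  F (tmap (tmap Delta id) id t * u)
    = F (tmap (tens (1 ⊗ 1)) id (tmap (tforml eps) id t) * u).
Proof.
apply: (tensor4_ext (g := fun u => F (_ * u)) (h := fun u => F (_ * u)))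
  => [||a b c e].
- exact: Fl_mulr.
- exact: Fl_mulr.
apply: (tensor3_ext (g := fun t => F (tmap (tmap Delta id) id t * _))
  (h := fun t => F (tmap (tens (1 ⊗ 1)) id (tmap (tforml eps) id t) * _)))
  => [||x y z].
- refine (linear_comp (Fl_mull _) _); linearity.
- refine (linear_comp (Fl_mull _) _); linearity.
have split_first d : F ((d ⊗ y ⊗ z) * (a ⊗ b ⊗ c ⊗ e))
    = sweedler (fun p q => s (p * a) * q) d * b * S (y * c) * (z * e).
  apply: (tensor_linear_ext (g := fun d => F ((d ⊗ y ⊗ z) * _))
    (h := fun d => sweedler _ d * _ * _ * _)) => [||p q].
  - refine (linear_comp (Fl_mull _) _); linearity.
  - by linearity.
  rewrite !tensorM F_tens sweedler_tensE; [|linearity|linearity].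
  by rewrite !mulrA.
rewrite !tmapE; try by linearity.
rewrite split_first s_left tformlE.
rewrite !tensorM F_tens !mul1r -!scalerAl (linear_homogeneous _ _ Sl).
by rewrite -!(scalerAl, scalerAr).
Qed.

Let F_collapse_middle (u : (A ⊗ A ⊗ A ⊗ A)%type) (t : (A ⊗ A ⊗ A)%type) :
  F (u * tmap (fun d => tassocl (tmap id Delta d)) id t)
    = F (u * tmap (fun x => x ⊗ 1 ⊗ 1) id (tmap (tformr eps) id t)).
Proof.
apply: (tensor4_ext (g := fun u => F (u * _)) (h := fun u => F (u * _)))
  => [||a b c e].
- exact: Fl_mull.
- exact: Fl_mull.
apply: (tensor3_ext
  (g := fun t => F (_ * tmap (fun d => tassocl (tmap id Delta d)) id t))
  (h := fun t => F (_ * tmap (fun x => x ⊗ 1 ⊗ 1) id (tmap (tformr eps) id t))))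
  => [||x y z].
- refine (linear_comp (Fl_mulr _) _); linearity.
- refine (linear_comp (Fl_mulr _) _); linearity.
have split_middle d : F ((a ⊗ b ⊗ c ⊗ e) * (tassocl (x ⊗ d) ⊗ z))
    = s (a * x) * b * sweedler (fun p q => p * S (c * q)) d * (e * z).
  apply: (tensor_linear_ext (g := fun d => F (_ * (tassocl (_ ⊗ d) ⊗ _)))
    (h := fun d => _ * sweedler _ d * _)) => [||p q].
  - refine (linear_comp (Fl_mulr _) _); linearity.
  - by linearity.
  rewrite tassocl_tens !tensorM F_tens sweedler_tensE; [|linearity|linearity].
  by rewrite !mulrA.
rewrite !tmapE; try by linearity.
rewrite split_middle (pa_right hS) tformrE.
rewrite !tensorM F_tens !mulr1 -[a * (_ *: _)]scalerAr (linear_homogeneous _ _ sl).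
by rewrite -!(scalerAl, scalerAr).
Qed.

(** [F] applied to the pentagon multiplied on the right by [phi ⊗ 1], which
cancels the factor [Phi ⊗ 1]. *)
Lemma reassociator_inverse_norm :
  sweedler3 (fun x y z => s x * y * S z) phi = 1.
Proof.
have F_phi t : F (t ⊗ 1) = sweedler3 (fun x y z => s x * y * S z) t.
  apply: (tensor3_ext (g := fun t => F (t ⊗ 1))) => [||x y z].
  - by linearity.
  - by apply: sweedler3_linear; linearity.
  rewrite F_tens mulr1 sweedler3_tensE //; by linearity.
have F_Phi t : F (tmap (@tassocl _ A A A) id (tassocl (1 ⊗ t)))
    = sweedler3 (fun x y z => x * S y * z) t.
  apply: (tensor3_ext (g := fun t => F (tmap _ id (tassocl (1 ⊗ t))))) => [||x y z].
  - by linearity.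
  - by apply: sweedler3_linear; linearity.
  rewrite tassocl_tens tmapE; [|linearity|linearity].
  rewrite tassocl_tens F_tens s1 mul1r sweedler3_tensE //; by linearity.
rewrite -F_phi; transitivity (F (tmap (@tassocl _ A A A) id (tassocl (1 ⊗ Phi))));
  last by rewrite F_Phi (pa_norm hS).
have pentagon_phi := congr1 (fun t => F (t * (phi ⊗ 1))) (qb_pentagon qb).
move: pentagon_phi; rewrite -!mulrA tensorM (qb_invr qb) mulr1.
rewrite F_collapse_right (qb_unitr qb) mul1r.
rewrite F_collapse_left (qb_unitl qb) tmapE; [|linearity|linearity].
rewrite mul1r mulr1 F_collapse_middle (qb_unitm qb) tmapE; [|linearity|linearity].
by rewrite mulr1.
Qed.

End Pentagon.

(** * The antipode attached to a central reassociator *)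

Section CentralReassociator.
Variables (k : fieldType) (A : algType k).
Variables (Delta : {lrmorphism A -> (A ⊗ A)%type})
          (eps : {lrmorphism A -> k | *%R}).
Variables (Phi phi : (A ⊗ A ⊗ A)%type) (S : A -> A).
Hypotheses (qb : is_quasi_bialgebra Delta eps Phi phi)
           (hS : is_preantipode Delta eps Phi S).
Hypothesis PhiC : forall t : (A ⊗ A ⊗ A)%type, Phi * t = t * Phi.

Let s a := sweedler3 (fun x y z => x * S (a * y) * z) Phi.

Let Sl : linear S. Proof. exact: pa_linear hS. Qed.

(** [Phi] is central and invertible, hence cancels from both sides of the
quasi-coassociativity law. *)
Lemma central_bialgebra : is_bialgebra Delta eps.
Proof.
split; [move=> a|exact: qb_counitl qb|exact: qb_counitr qb].
have /(congr1 ( *%R^~ phi)) := qb_coassoc qb a.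
by rewrite PhiC -!mulrA (qb_invr qb) !mulr1.
Qed.

Lemma central_antipode_linear : linear s.
Proof. by rewrite /s; linearity. Qed.

Lemma central_antipode1 : s 1 = 1.
Proof.
rewrite -[RHS](pa_norm hS); apply: eq_sweedler3 => x y z.
by rewrite mul1r.
Qed.

(** The leg a_2 crosses the third leg of [Phi] to sit right after [S], where
the left preantipode law applies. *)
Lemma central_antipode_left a b :
  sweedler (fun x y => s (x * b) * y) (Delta a) = eps a *: s b.
Proof.
transitivity (sweedler (fun p q =>
    sweedler3 (fun x y z => x * (S (p * (b * y)) * q) * z) Phi) (Delta a)).
  apply: eq_sweedler => p q; rewrite sweedler3_mull.
  transitivity (sweedler3 (fun x y z => (x * 1) * S (p * b * (y * 1)) * (z * q)) Phi).
    by apply: eq_sweedler3 => x y z; rewrite !mulr1 mulrA.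
  rewrite (@sweedler3_central _ _ _ (fun x y z => x * S (p * b * y) * z));
    try (exact: PhiC || linearity).
  by apply: eq_sweedler3 => x y z; rewrite !mul1r !mulrA.
apply: (etrans (exchange_sweedler3
  (fun p q x y z => x * (S (p * (b * y)) * q) * z) _ _)).
rewrite sweedler3_scale; apply: eq_sweedler3 => x y z.
by rewrite -sweedler_mull -sweedler_mulr (pa_left hS) -scalerAr -scalerAl.
Qed.

(** Both legs are moved: a_1 crosses the first leg of [Phi] and a_2 the
second, giving Phi^1 a_1 S(Phi^2 a_2) Phi^3. *)
Lemma central_antipode_right a : sweedler (fun x y => x * s y) (Delta a) = eps a *: 1.
Proof.
transitivity (sweedler (fun p q =>
    sweedler3 (fun x y z => x * (p * S (y * q)) * z) Phi) (Delta a)).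
  apply: eq_sweedler => p q; rewrite sweedler3_mulr.
  transitivity (sweedler3 (fun x y z => (p * x) * S (q * y) * (1 * z)) Phi).
    by apply: eq_sweedler3 => x y z; rewrite mul1r !mulrA.
  rewrite -(@sweedler3_central _ _ _ (fun x y z => x * S y * z));
    try (exact: PhiC || linearity).
  by apply: eq_sweedler3 => x y z; rewrite !mulr1 !mulrA.
apply: (etrans (exchange_sweedler3
  (fun p q x y z => x * (p * S (y * q)) * z) _ _)).
rewrite -[in RHS](pa_norm hS) sweedler3_scale.
apply: eq_sweedler3 => x y z.
by rewrite -sweedler_mull -sweedler_mulr (pa_right hS) -scalerAr -scalerAl.
Qed.

(** Cancellation for a |-> s(a b), whose convolution with the identity is
eps times s(b) by [central_antipode_left]. *)
Lemma central_antipode_antimul a b : s (a * b) = s b * s a.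
Proof.
have sl := central_antipode_linear.
apply: (antipode_cancel central_bialgebra sl (f := fun a => s (a * b))).
- by linearity.
- exact: central_antipode_right.
- by move=> a'; exact: central_antipode_left.
Qed.

Lemma preantipode_eq_mul_antipode a : S a = S 1 * s a.
Proof.
apply: (antipode_cancel central_bialgebra central_antipode_linear Sl).
- exact: central_antipode_right.
- move=> a'; rewrite -(pa_left hS); apply: eq_sweedler => x y.
  by rewrite mulr1.
Qed.

End CentralReassociator.

Theorem proposition4p13 (k : fieldType) (A : algType k)
    (Delta : {lrmorphism A -> (A ⊗ A)%type})
    (eps : {lrmorphism A -> k | *%R})
    (Phi phi : A ⊗ A ⊗ A) (S : A -> A)
    (hA : is_quasi_bialgebra Delta eps Phi phi)
    (hS : is_preantipode Delta eps Phi S)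
    (hPhi : forall t : A ⊗ A ⊗ A, Phi * t = t * Phi) :
  let s := fun a : A => sweedler3 (fun x y z => x * S (a * y) * z) Phi in
  let alpha : A := 1 in
  let beta : A := S 1 in
  [/\ is_hopf Delta eps s,
      is_quasi_hopf Delta eps Phi phi s alpha beta
    & forall a : A, S a = beta * s a].
Proof.
move=> s alpha beta.
have sl : linear s := central_antipode_linear hS.
have s1 : s 1 = 1 := central_antipode1 hS.
have s_left a b : sweedler (fun x y => s (x * b) * y) (Delta a) = eps a *: s b.
  exact: central_antipode_left.
have S_s a : S a = beta * s a := preantipode_eq_mul_antipode hA hS hPhi a.
have antipode_left a : sweedler (fun x y => s x * y) (Delta a) = eps a *: 1.
  rewrite -[in RHS]s1 -s_left; apply: eq_sweedler => x y.
  by rewrite mulr1.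
split=> //; split=> //.
- exact: central_bialgebra hA hPhi.
- exact: central_antipode_right.
- exact: central_antipode_antimul hA hS hPhi.
- move=> a; rewrite -antipode_left; apply: eq_sweedler => x y.
  by rewrite mulr1.
- move=> a; rewrite -(pa_right hS); apply: eq_sweedler => x y.
  by rewrite mul1r -mulrA -S_s.
- rewrite -[RHS](pa_norm hS); apply: eq_sweedler3 => x y z.
  by rewrite mulr1 -[x * beta * s y]mulrA -S_s.
- rewrite -[RHS](reassociator_inverse_norm hA hS sl s1 s_left).
  by apply: eq_sweedler3 => x y z; rewrite mulr1 -mulrA -S_s.
Qed.
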